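(* Let $\lambda$ be a regular cardinal with $\lambda>\aleph_1$. Suppose $S\subseteq\lambda$ is a stationary, non-reflecting set which carries a diamond sequence $\langle A_\alpha:\alpha\in S\rangle$, and $S^*$ is a non-reflecting stationary subset of $\lambda$ with $S^*\cap S=\emptyset$ and $\mathrm{cf}\,\delta>\aleph_0$ for every $\delta\in S^*$. Then there are sequences $\overline C=\langle c_\delta:\delta\in S^*\rangle$ and $\overline B=\langle B_\alpha:\alpha\in S\rangle$ such that: (i) $B_\alpha\subseteq\alpha$ for every $\alpha\in S$; (ii) for every $\delta\in S^*$, $\sup c_\delta=\delta$ and $c_\delta$ is a closed set of limit ordinals; (iii) if $\delta,\delta^*\in S^*$ and $\delta\in\mathrm{acc}\,c_{\delta^*}$, then there is some $\alpha<\delta$ such that $c_{\delta^*}\cap(\alpha,\delta)=c_\delta\cap(\alpha,\delta)$; (iv) for every club $E\subseteq\lambda$ and every set $X\subseteq\lambda$ there are stationarily many $\delta\in S^*$ such that $$\delta=\sup\{\alpha\in\mathrm{nacc}\,c_\delta:\ \alpha\in S\cap E\ \text{and}\ X\cap\alpha=B_\alpha\}.$$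
   Context: A stationary set $T\subseteq\lambda$ is non-reflecting if there is no ordinal $\alpha<\lambda$ of uncountable cofinality such that $T\cap\alpha$ is stationary in $\alpha$. A diamond sequence on $S$ is a sequence $\langle A_\alpha:\alpha\in S\rangle$ with $A_\alpha\subseteq\alpha$ such that for every $X\subseteq\lambda$ the set $\{\alpha\in S: X\cap\alpha=A_\alpha\}$ is stationary in $\lambda$. For a set of ordinals $C$, $\mathrm{acc}\,C$ is the set of accumulation points of $C$ (ordinals $\alpha>0$ with $\alpha=\sup(C\cap\alpha)$) and $\mathrm{nacc}\,C=C\setminus\mathrm{acc}\,C$; $(\alpha,\delta)$ denotes the open interval of ordinals. *)

(* Defs.v *)
From mathcomp Require Import all_boot all_order.
From mathcomp Require Import boolp classical_sets functions cardinality.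

Set Implicit Arguments.
Unset Strict Implicit.
Unset Printing Implicit Defensive.

Import Order.TTheory.
Local Open Scope order_scope.
Local Open Scope classical_set_scope.
Local Open Scope card_scope.

(* A cardinal lambda is presented by a well-ordered type L of that order type:
   the elements of L are the ordinals below lambda, and subsets of lambda are
   the sets of type [set L].  An ordinal regarded as the set of its
   predecessors is an initial segment of L: [below a] for a < lambda, and
   [setT] for lambda itself.  The notions that are needed both for lambda and
   for ordinals below lambda take such an initial segment D as argument. *)

Section Ordinals.
Context {d : Order.disp_t} {L : orderType d}.
Implicit Types (D K C T S X : set L) (a b g : L).

Definition below a : set L := [set b | b < a].

Definition open_interval a b : set L := [set g | a < g < b].

Definition limit_ordinal a : Prop :=
  (exists b, b < a) /\ (forall b, b < a -> exists2 g, b < g & g < a).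

(* [supremums A a] says that a is the least upper bound of A; the condition
   [exists b, b < a] is a > 0. *)
Definition acc C : set L :=
  [set a | (exists b, b < a) /\ supremums (C `&` below a) a].

Definition nacc C : set L := C `\` acc C.

Definition cofinal_in D C : Prop :=
  C `<=` D /\ (forall b, D b -> exists2 g, C g & b <= g).

(* [is_cofinality D K] is cf D = K: K is the least ordinal which has a map
   onto a cofinal subset of D. *)
Definition is_cofinality D K : Prop :=
  [/\ forall a b, K a -> b < a -> K b,
      exists f : L -> L, cofinal_in D (f @` K)
    & forall a, K a -> ~ exists f : L -> L, cofinal_in D (f @` below a)].

Definition uncountable_cofinality a : Prop :=
  exists k : L, is_cofinality (below a) (below k) /\ ~ countable (below k).

Definition closed_in D C : Prop := forall a, D a -> acc C a -> C a.

Definition club_in D C : Prop := cofinal_in D C /\ closed_in D C.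

Definition stationary_in D T : Prop :=
  T `<=` D /\ (forall C, club_in D C -> T `&` C !=set0).

Definition club C : Prop := club_in [set: L] C.

Definition stationary T : Prop := stationary_in [set: L] T.

Definition non_reflecting T : Prop :=
  ~ exists a, uncountable_cofinality a /\ stationary_in (below a) (T `&` below a).

Definition diamond_sequence S (A : L -> set L) : Prop :=
  (forall a, S a -> A a `<=` below a) /\
  (forall X, stationary [set a | S a /\ X `&` below a = A a]).

Definition is_omega1 a : Prop :=
  ~ countable (below a) /\ (forall b, b < a -> countable (below b)).

End Ordinals.

(* The order type of L is a regular cardinal: an infinite initial ordinal that
   is its own cofinality. *)
Definition regular_cardinal (d : Order.disp_t) (L : orderType d) : Prop :=
  [/\ well_founded (fun a b : L => a < b),
      infinite_set [set: L],
      forall a : L, ~ ([set: L] #<= below a)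
    & is_cofinality [set: L] [set: L]].

(* As L is an initial ordinal, lambda > aleph_1 means that the ordinal omega_1
   is one of the elements of L. *)
Definition gt_aleph1 (d : Order.disp_t) (L : orderType d) : Prop :=
  exists a : L, is_omega1 a.

(* Main.v *)
Require Import Defs.
From mathcomp Require Import all_boot all_order.
From mathcomp Require Import boolp classical_sets functions cardinality.

Set Implicit Arguments.
Unset Strict Implicit.
Unset Printing Implicit Defensive.

Import Order.TTheory.
Local Open Scope order_scope.
Local Open Scope classical_set_scope.

(** Fix for every ordinal b a club e b of b whose accumulation points avoid S
    and Sstar; it exists because both sets are non-reflecting.  For T included
    in S, walk from delta down towards a target g through these clubs, replacing
    each chosen ladder point x by sup (T `&` [0, x]) and stopping at the first
    member of T.  The set of points so reached is a club of delta (if T is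
    unbounded in delta) in which the members of T are isolated; accumulation
    points in Sstar can only arise by passing to the walk from that point itself,
    which is coherence.

    Suppose that all these systems fail to guess.  Let A alpha code a sequence of
    sets B n alpha, and shrink T n to T n.+1 by keeping the points that lie in
    the club and guess the set witnessing the failure for T n and B n.  By diamond
    the intersection of the T n is stationary.  As T n shrinks, each walk towards
    a point of the intersection is eventually constant, with an end point in the
    intersection; since cf delta is uncountable, a single n works for cofinally
    many targets below delta, so the system of T n guesses after all. *)

(** * Accumulation points *)

Section Accumulation.
Context {d : Order.disp_t} {L : orderType d}.
Implicit Types (C D T : set L) (a b g : L).

Lemma accP C a :
  acc C a <-> (exists b, b < a) /\ forall b, b < a -> exists2 g, C g & b < g < a.
Proof.
split=> -[a0 H]; split=> //.
  move=> b ba; apply: contrapT => nex; suff: a <= b by rewrite leNgt ba.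
  apply: H.2 => g [Cg /= ga].
  by rewrite leNgt; apply/negP => bg; apply: nex; exists g; rewrite ?bg.
split; first by move=> g [_] /= /ltW.
move=> b ub; rewrite leNgt; apply/negP => ba; have [g Cg /andP[bg ga]] := H _ ba.
by have := ub g (conj Cg ga); rewrite leNgt bg.
Qed.

Lemma acc_sub C D a : C `<=` D -> acc C a -> acc D a.
Proof.
move=> CD /accP[a0 H]; apply/accP; split=> // b /H[g /CD Dg gP].
by exists g.
Qed.

Lemma acc_acc C a : acc (acc C) a -> acc C a.
Proof.
move=> /accP[a0 H]; apply/accP; split=> // b /H[g /accP[_ Cg] /andP[/Cg[h Ch /andP[bh hg]] ga]].
by exists h; rewrite ?bh ?(lt_trans hg).
Qed.

Lemma acc_limit C a : acc C a -> limit_ordinal a.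
Proof. by move=> /accP[a0 H]; split=> // b /H[g _ /andP[]]; exists g. Qed.

Lemma not_acc_gap C a : (exists b, b < a) -> ~ acc C a ->
  exists2 z, z < a & forall g, C g -> z < g -> a <= g.
Proof.
move=> a0 naccC; apply: contrapT => nz; apply: naccC; apply/accP; split=> // b ba.
apply: contrapT => ng; apply: nz; exists b => // g Cg bg; rewrite leNgt.
by apply/negP => ga; apply: ng; exists g; rewrite ?bg.
Qed.

Lemma limit_supremums C a : limit_ordinal a -> C `<=` below a ->
  (forall b, b < a -> exists2 g, C g & b <= g) -> supremums C a.
Proof.
move=> [_ lim] Ca cof; split; first by move=> g /Ca /ltW.
move=> b ub; rewrite leNgt; apply/negP => /lim[h bh /cof[g Cg hg]].
by have := ub g Cg; rewrite leNgt (lt_le_trans bh hg).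
Qed.

End Accumulation.

(** * Clubs and bounded sequences in a well-order *)

Section WellOrder.
Context {d : Order.disp_t} {L : orderType d}.
Context (Lwf : well_founded (fun a b : L => a < b)).
Implicit Types (C D K T : set L) (a b g : L).

Lemma ex_least C : C !=set0 -> exists2 a, C a & forall b, C b -> a <= b.
Proof.
move=> [x Cx]; apply: contrapT => nC; have : forall a, ~ C a.
  apply: (well_founded_ind Lwf) => a IH Ca; apply: nC; exists a => // b Cb.
  by rewrite leNgt; apply/negP => /IH; apply.
by move=> /(_ x).
Qed.

Lemma ex_supremum C b : ubound C b -> exists a, supremums C a.
Proof. by move=> ub; have [|a Ca al] := @ex_least (ubound C); [exists b|exists a]. Qed.

Lemma nonincreasing_stable (u : nat -> L) :
  (forall m n, (m <= n)%N -> u n <= u m) ->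
  exists N, forall n, (N <= n)%N -> u n = u N.
Proof.
move=> mono; have [|a [N _ <-] al] := @ex_least (range u); first by exists (u 0), 0.
exists N => n Nn; apply/eqP; rewrite eq_le mono //=; apply: al; exact: imageP.
Qed.

(** The working form of uncountable cofinality, stated for a set [D] so that it serves both lambda
    and the points of [Sstar]. *)
Definition seq_bounded D :=
  forall f : nat -> L, (forall n, D (f n)) -> exists2 b, D b & forall n, f n < b.

(** An unbounded sequence could be reindexed by some [below a] with [a] in [K], against the
    minimality of [K]. *)
Lemma cofinality_seq_bounded D K :
  is_cofinality D K -> ~ countable K -> seq_bounded D.
Proof.
move=> [Kdown [f0 f0cof] Kmin] Kunc f Df.
(* An uncountable [K] is not a countable union of finite sets, so some proper initial segment
   [below a] maps onto the naturals. *)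
have [a Ka [g gsurj]] : exists2 a, K a &
    exists g : L -> nat, forall n, exists2 x, x < a & g x = n.
  have infP C : infinite_set C -> exists g : L -> nat, set_surj C setT g.
    by move=> /infiniteP/pcard_surjP.
  have [|g gsurj] := infP K; first by move=> /finite_set_countable.
  have /choice[h hP] n : exists x, K x /\ g x = n by have [x] := gsurj n I; exists x.
  have [[a Ka ha]|nb] := pselect (exists2 a, K a & forall n, h n < a).
    by exists a => //; exists g => n; exists (h n) => //; case: (hP n).
  have [[n ninf]|nfin] := pselect (exists n, infinite_set (below (h n))).
    exists (h n); first by case: (hP n).
    have [g' g's] := infP _ ninf; exists g' => m.
    by have [x] := g's m I; exists x.
  exfalso; apply: Kunc; apply: (@sub_countable _ _ _ (\bigcup_n (below (h n) `|` [set h n]))).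
    apply: subset_card_le => x Kx; apply: contrapT => nx; apply: nb; exists x => // n.
    rewrite ltNge; apply/negP; rewrite le_eqVlt => /orP xh; apply: nx; exists n => //.
    by case: xh => [/eqP|]; [right|left].
  apply: bigcup_countable => // n _; apply: finite_set_countable.
  rewrite finite_setU; split; last exact: finite_set1.
  by apply: contrapT => ninf; apply: nfin; exists n.
apply: contrapT => nb; apply: (Kmin _ Ka); exists (f \o g); split.
  by move=> _ [x _ <-]; exact: Df.
move=> b Db; apply: contrapT => nx; apply: nb; exists b => // n.
rewrite ltNge; apply/negP => bf; apply: nx; have [x xa gx] := gsurj n.
by exists (f n) => //; exists x => //=; rewrite gx.
Qed.

Lemma uncountable_cofinality_seq_bounded a :
  uncountable_cofinality a -> seq_bounded (below a).
Proof. by move=> [k [ck unc]]; exact: cofinality_seq_bounded ck unc. Qed.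

Lemma uncountable_cofinality_limit a :
  uncountable_cofinality a -> limit_ordinal a.
Proof.
move=> ua; split; last first.
  move=> b ba; have [//|g ga bg] := uncountable_cofinality_seq_bounded ua (f := fun=> b).
  by exists g => //; exact: (bg 0).
case: ua => k [[_ [f [fa _]] _] unc]; apply: contrapT => a0; apply: unc.
suff -> : below k = set0 by exact: countable0.
rewrite -subset0 => x kx; apply: a0; exists (f x); apply: fa; exact: imageP.
Qed.

Definition initial D := forall a b, D b -> a < b -> D a.

Lemma below_initial a : initial (below a).
Proof. by move=> g b /= ba gb; exact: lt_trans ba. Qed.

Lemma setT_initial : initial [set: L].
Proof. by []. Qed.

(** Interleaving: [u m.+1] exceeds, for every [n], a point of [C n] above [u m], so the least strict
    bound of [u] accumulates all the [C n]. *)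
Lemma ex_acc_above D (C : nat -> set L) b : initial D -> seq_bounded D ->
  (forall n, cofinal_in D (C n)) -> D b ->
  exists a, [/\ D a, b < a & forall n, acc (C n) a].
Proof.
move=> Dini Dseq Ccof Db.
have Dup x : D x -> exists2 y, D y & x < y.
  by move=> Dx; have [//|y Dy xy] := Dseq (fun=> x); exists y => //; exact: (xy 0).
have next x : exists y, D x -> [/\ D y, x < y & forall n, exists2 g, C n g & x < g < y].
  have [Dx|] := pselect (D x); last by exists x.
  have [x' Dx' xx'] := Dup _ Dx.
  have /choice[g gP] n : exists g, C n g /\ x' <= g.
    by have [g] := (Ccof n).2 _ Dx'; exists g.
  have [n|y Dy gy] := Dseq g; first by apply: (Ccof n).1; case: (gP n).
  have xg n : x < g n by case: (gP n) => _; exact: lt_le_trans.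
  exists y => _; split=> //; first exact: lt_trans (gy 0).
  by move=> n; exists (g n); rewrite ?xg ?gy //; case: (gP n).
have [nx nxP] := choice next.
pose u n := iter n nx b.
have Du n : D (u n) by elim: n => //= n /nxP[].
have [v Dv uv] := Dseq u Du.
have [|a aub amin] := @ex_least [set a | forall n, u n < a]; first by exists v.
have ua x : x < a -> exists n, x <= u n.
  move=> xa; apply: contrapT => nn; suff: a <= x by rewrite leNgt xa.
  by apply: amin => n; rewrite ltNge; apply/negP => xu; apply: nn; exists n.
exists a; split; [|exact: (aub 0)|].
  have := amin v uv; rewrite le_eqVlt => /orP[/eqP ->//|av]; exact: Dini av.
move=> n; apply/accP; split=> [|x /ua[m xm]]; first by exists b; exact: (aub 0).
have [_ _ /(_ n)[g Cg /andP[ug gu]]] := nxP _ (Du m).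
by exists g; rewrite ?(le_lt_trans xm ug) ?(lt_trans gu (aub m.+1)).
Qed.

Lemma bigcap_club_in D (C : nat -> set L) : initial D -> seq_bounded D ->
  (forall n, club_in D (C n)) -> club_in D (\bigcap_n C n).
Proof.
move=> Dini Dseq Cclub; split.
  split; first by move=> x /(_ 0 I); apply: (Cclub 0).1.1.
  move=> b Db; have [n|a [Da ba aC]] := ex_acc_above Dini Dseq (C := C) _ Db.
    exact: (Cclub n).1.
  by exists a; [move=> n _; apply: (Cclub n).2|exact: ltW].
move=> a Da aC n _; apply: (Cclub n).2 => //; apply: acc_sub aC.
exact: bigcap_inf.
Qed.

Lemma setI_club_in D C1 C2 : initial D -> seq_bounded D ->
  club_in D C1 -> club_in D C2 -> club_in D (C1 `&` C2).
Proof.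
move=> Dini Dseq c1 c2.
have := @bigcap_club_in D (fun n => if n is 0 then C1 else C2) Dini Dseq.
suff -> : \bigcap_n (if n is 0 then C1 else C2) = C1 `&` C2 by apply; case.
apply/seteqP; split=> [x xC|x [x1 x2] [|n]//].
by split; [exact: (xC 0)|exact: (xC 1)].
Qed.

Lemma acc_club_in D C : initial D -> seq_bounded D ->
  cofinal_in D C -> club_in D (acc C `&` D).
Proof.
move=> Dini Dseq Ccof; split.
  split=> [x []//|b Db].
  have [|a [Da ba aC]] := ex_acc_above Dini Dseq (C := fun=> C) _ Db; first by [].
  by exists a; [split=> //; exact: (aC 0)|exact: ltW].
by move=> a Da aC; split=> //; apply: acc_acc; apply: acc_sub aC => x [].
Qed.

End WellOrder.

(** * Ladders whose accumulation points avoid two non-reflecting sets *)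

Section Ladder.
Context {d : Order.disp_t} {L : orderType d}.
Context (Lwf : well_founded (fun a b : L => a < b)).
Implicit Types (C D K T S : set L) (a b g : L).

(** The least length of a cofinal map is the cofinality, here countable; an injection of it into the
    naturals is inverted. *)
Lemma countable_cofinal_seq b a : ~ uncountable_cofinality b -> a < b ->
  exists u : nat -> L, (forall n, u n < b) /\ forall g, g < b -> exists n, g <= u n.
Proof.
move=> nunc ab.
have [|k [f [fb fcof]] kmin] := @ex_least _ _ Lwf
    [set k | exists f : L -> L, cofinal_in (below b) (f @` below k)].
  by exists b, id; rewrite image_id; split=> // g; exists g.
have kcount : countable (below k).
  apply: contrapT => unc; apply: nunc; exists k; split=> //; split.
  - by move=> g c gk cg; exact: below_initial gk cg.
  - by exists f.
  - by move=> g gk exf; have := kmin g exf; rewrite leNgt gk.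
have [_ [x0 x0k _] _] := fcof a ab.
have /countable_injP[h hinj] := kcount.
(* Numbers that [h] does not take get the default [x0]. *)
have /choice[v vP] n : exists x, x < k /\ forall y, y < k -> h y = n -> y = x.
  have [[x [xk hx]]|nx] := pselect (exists x, x < k /\ h x = n).
    exists x; split=> // y yk hy; apply: hinj; rewrite ?inE //; congruence.
  by exists x0; split=> // y yk hy; exfalso; apply: nx; exists y.
exists (f \o v); split=> [n|g gb].
  by apply: fb; exists (v n) => //; case: (vP n).
have [_ [y yk <-] gy] := fcof g gb.
by exists (h y) => /=; have [_ /(_ _ yk erefl) <-] := vP (h y).
Qed.

(* In countable cofinality the ladder has no accumulation point at all. *)
Lemma ex_ladder S1 S2 b : non_reflecting S1 -> non_reflecting S2 ->
  exists e, [/\ club_in (below b) e, forall g, g < b -> acc e g -> ~ S1 g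
    & forall g, g < b -> acc e g -> ~ S2 g].
Proof.
move=> nr1 nr2; have [unc|cnt] := pselect (uncountable_cofinality b).
  (* If [T] met every club of [b], it would reflect at [b], whose cofinality is uncountable. *)
  have club T : non_reflecting T -> exists2 C, club_in (below b) C & T `&` C = set0.
    move=> nr; apply: contrapT => nC; apply: nr; exists b; split=> //.
    split=> [x []//|C clubC]; apply: contrapT => nTC; apply: nC; exists C => //.
    rewrite -subset0 => x [Tx Cx]; apply: nTC; exists x; split=> //; split=> //.
    exact: clubC.1.1.
  have [C1 club1 S1C] := club _ nr1; have [C2 club2 S2C] := club _ nr2.
  have clubI := setI_club_in Lwf (@below_initial _ _ b)
    (uncountable_cofinality_seq_bounded unc) club1 club2.
  exists (C1 `&` C2); split=> // g gb /(clubI.2 _ gb)[C1g C2g] Sg.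
    by suff: set0 g by []; rewrite -S1C.
  by suff: set0 g by []; rewrite -S2C.
have [[a ab]|b0] := pselect (exists a, a < b); last first.
  exists set0; split; try by move=> g gb; case: b0; exists g.
  split; last by move=> g gb; case: b0; exists g.
  by split=> // g gb; case: b0; exists g.
have [u [ub ucof]] := countable_cofinal_seq cnt ab.
(* Running maxima make the sequence monotone, so only finitely many of its values lie below a given
   [g < b]. *)
pose v := fix v n := if n is n'.+1 then Order.max (v n') (u n) else u 0.
have vb n : v n < b by elim: n => //= n IH; rewrite gt_max IH ub.
have uv n : u n <= v n by case: n => //= n; rewrite le_max lexx orbT.
have vmono m n : (m <= n)%N -> v m <= v n.
  elim: n => [|n IH]; first by rewrite leqn0 => /eqP ->.
  rewrite leq_eqVlt => /orP[/eqP -> //|/IH vmn] /=.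
  by rewrite le_max vmn.
have no_acc g : g < b -> ~ acc (range v) g.
  move=> gb /accP[[x xg] H].
  have [N gN] := ucof g gb.
  have gvN : exists N, g <= v N by exists N; exact: le_trans (uv N).
  have [[|m] gm mmin] := ex_minnP gvN.
    have [_ [n _ <-] /andP[_ vg]] := H x xg.
    by have := lt_le_trans vg (le_trans gm (vmono 0 n isT)); rewrite ltxx.
  have mg : v m < g by rewrite ltNge; apply/negP => /mmin; rewrite ltnn.
  have [_ [n _ <-] /andP[mn ng]] := H _ mg.
  have [nm|mn'] := leqP n m.
    by have := lt_le_trans mn (vmono _ _ nm); rewrite ltxx.
  by have := lt_le_trans ng (le_trans gm (vmono _ _ mn')); rewrite ltxx.
exists (range v); split; try by move=> g gb /(no_acc g gb).
split; last by move=> g gb /(no_acc g gb).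
split=> [_ [n _ <-]//|g gb]; first exact: vb.
have [n gn] := ucof g gb; exists (v n); [exact: imageP|exact: le_trans (uv n)].
Qed.

End Ladder.

(** * Walks through the ladders *)

Section Walk.
Context {d : Order.disp_t} {L : orderType d}.
Context (Lwf : well_founded (fun a b : L => a < b)).
Context (e : L -> set L).
Context (e_club : forall b, club_in (below b) (e b)).
Implicit Types (T : set L) (a b g x y z : L).

Definition closure T : set L := T `|` acc T.

(* One step of the walk from b towards g: with x the least point of the ladder
   e b above g, the step leads to y = sup (T `&` [0, x]). *)
Definition walk_step T b g y : Prop :=
  exists x, [/\ e b x, g <= x, forall x', e b x' -> g <= x' -> x <= x'
              & supremums [set t | T t /\ t <= x] y].

(* The points that the walk from b reaches without passing through T before. *)
Inductive reach T : L -> L -> Prop :=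
| reach_hit b g : closure T g -> walk_step T b g g -> reach T b g
| reach_step b g y : walk_step T b g y -> g < y -> ~ T y -> reach T y g ->
    reach T b g.

Lemma supremums_unique T a b : supremums T a -> supremums T b -> a = b.
Proof. by move=> Ta Tb; exact: is_subset1_supremums Ta Tb. Qed.

Lemma walk_step_unique T b g y y' :
  walk_step T b g y -> walk_step T b g y' -> y = y'.
Proof.
move=> [x [ex gx xmin xy]] [x' [ex' gx' xmin' xy']].
have xx : x = x' by apply/eqP; rewrite eq_le xmin ?xmin'.
by apply: supremums_unique xy _; rewrite xx.
Qed.

Lemma walk_step_lt T b g y : walk_step T b g y -> y < b.
Proof.
move=> [x [ex _ _ [_ ymin]]]; apply: le_lt_trans ((e_club b).1.1 x ex).
by apply: ymin => t [].
Qed.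

Lemma ex_first b g : g < b ->
  exists x, [/\ e b x, g <= x & forall x', e b x' -> g <= x' -> x <= x'].
Proof.
move=> gb; have [|x [ex gx] xmin] := ex_least Lwf (C := [set x | e b x /\ g <= x]).
  by have [x ex gx] := (e_club b).1.2 g gb; exists x.
by exists x; split=> // x' ex' gx'; exact: xmin.
Qed.

Lemma ex_walk_step T b g : g < b -> exists y, walk_step T b g y.
Proof.
move=> /ex_first[x [ex gx xmin]].
have [|y yP] := ex_supremum Lwf (C := [set t | T t /\ t <= x]) (b := x).
  by move=> t [].
by exists y, x.
Qed.

Lemma closure_le T x y g : supremums [set t | T t /\ t <= x] y ->
  closure T g -> g <= x -> g <= y.
Proof.
move=> [yub _] [Tg|/accP[_ gT]] gx; first exact: yub.
rewrite leNgt; apply/negP => /gT[t Tt /andP[yt tg]].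
by have := yub t (conj Tt (ltW (lt_le_trans tg gx))); rewrite leNgt yt.
Qed.

Lemma walk_step_ge T b g y : closure T g -> walk_step T b g y -> g <= y.
Proof. by move=> Tg [x [_ gx _ xy]]; exact: closure_le xy Tg gx. Qed.

Lemma walk_step_between T b g y t :
  walk_step T b g y -> g <= t -> t <= y -> walk_step T b t y.
Proof.
move=> [x [ex gx xmin xy]] gt ty; exists x; split=> //.
  by apply: le_trans ty _; apply: xy.2 => s [].
by move=> x' ex' tx'; apply: xmin => //; exact: le_trans tx'.
Qed.

(** No ladder point separates [t] from [g], so both have the same first ladder point: walks towards
    nearby targets start alike. *)
Lemma walk_step_gap T b g y z t : walk_step T b g y ->
  (forall x, e b x -> z < x -> g <= x) -> z < t -> t < g -> walk_step T b t y.
Proof.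
move=> [x [ex gx xmin xy]] gap zt tg; exists x; split=> //.
  by apply: le_trans gx; exact: ltW.
by move=> x' ex' tx'; apply: xmin => //; apply: gap => //; exact: lt_le_trans tx'.
Qed.

Lemma reach_closure T b g : reach T b g -> closure T g.
Proof. by elim. Qed.

Lemma reach_lt T b g : reach T b g -> g < b.
Proof.
elim=> [{}b {}g _ /walk_step_lt //|{}b {}g y /walk_step_lt yb gy _ _ _].
exact: lt_trans yb.
Qed.

Lemma reach_inv T b g y : walk_step T b g y -> reach T b g ->
  g = y \/ [/\ g < y, ~ T y & reach T y g].
Proof.
move=> by_ bg; case: bg by_ => [{}b {}g _ gg|{}b {}g y' by' gy' nT yg] by_.
  by left; exact: walk_step_unique gg by_.
by right; rewrite -(walk_step_unique by' by_).
Qed.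

(** Induction along the walk towards [g]. If [g] accumulates the current ladder, it lies on it and
    is hit. Otherwise targets just below [g] share the next step to [y]: a [y] in [T] blocks them,
    [y = g] outside [T] hands them over to the walk from [g], and a larger [y] outside [T] continues
    the induction. *)
Lemma reach_local T b g : T `<=` limit_ordinal -> closure T g -> g < b ->
  [\/ reach T b g /\ (exists2 b', g < b' & acc (e b') g),
      exists2 z, z < g & forall t, z < t -> t < g -> ~ reach T b t
    | [/\ ~ T g, reach T b g &
        exists2 z, z < g &
          forall t, z < t -> t < g -> reach T b t <-> reach T g t]].
Proof.
move=> Tlim Tg; elim/(well_founded_ind Lwf): b => b IH gb.
have g0 : exists z, z < g by case: Tg => [/Tlim[]//|[]].
have [accg|naccg] := pselect (acc (e b) g).
  have eg := (e_club b).2 g gb accg; apply: Or31; split; last by exists b.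
  have [|y yP] := ex_supremum Lwf (C := [set t | T t /\ t <= g]) (b := g).
    by move=> t [].
  have gy : g = y.
    apply/eqP; rewrite eq_le (closure_le yP Tg (lexx g)) /=.
    by apply: yP.2 => t [].
  apply: reach_hit => //; exists g; split=> //; by rewrite {2}gy.
have [z zg gap] := not_acc_gap g0 naccg.
have [y yP] := ex_walk_step T gb.
have stepy t : z < t -> t < g -> walk_step T b t y.
  by move=> zt tg; exact: walk_step_gap yP gap zt tg.
have := walk_step_ge Tg yP; rewrite le_eqVlt => /orP[/eqP gy|gy].
  have [Ty|nTy] := pselect (T y).
    apply: Or32; exists z => // t zt tg /(reach_inv (stepy t zt tg))[ty|[]//].
    by rewrite ty gy ltxx in tg.
  apply: Or33; split; [by rewrite gy|by apply: reach_hit => //; rewrite {2}gy|].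
  exists z => // t zt tg; split=> [/(reach_inv (stepy t zt tg))[ty|[_ _]]|].
  - by rewrite ty gy ltxx in tg.
  - by rewrite gy.
  - by rewrite gy; apply: reach_step => //; [exact: stepy|rewrite -gy].
have stepE t : ~ T y -> z < t -> t < g -> reach T b t <-> reach T y t.
  move=> nTy zt tg; split=> [/(reach_inv (stepy t zt tg))[ty|[]//]|].
    by have := lt_trans tg gy; rewrite ty ltxx.
  by apply: reach_step => //; [exact: stepy|exact: lt_trans gy].
have [Ty|nTy] := pselect (T y).
  apply: Or32; exists z => // t zt tg /(reach_inv (stepy t zt tg))[ty|[]//].
  by have := lt_trans tg gy; rewrite ty ltxx.
case: (IH y (walk_step_lt yP) gy) => [[yg exb]|[z' z'g H]|[nTg yg [z' z'g H]]].
- by apply: Or31; split=> //; exact: reach_step yP _ _ _.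
- apply: Or32; exists (Order.max z z'); first by rewrite gt_max zg.
  by move=> t; rewrite gt_max => /andP[zt z't] tg /(stepE t nTy zt tg); exact: H.
- apply: Or33; split=> //; first exact: reach_step yP _ _ _.
  exists (Order.max z z'); first by rewrite gt_max zg.
  move=> t; rewrite gt_max => /andP[zt z't] tg.
  by split=> [/(stepE t nTy zt tg)/(H t z't tg)|/(H t z't tg)/(stepE t nTy zt tg)].
Qed.

Lemma acc_reach T b g : acc (reach T b) g -> acc T g.
Proof.
move=> /accP[g0 H]; apply/accP; split=> // z /H[t bt /andP[zt tg]].
case: (reach_closure bt) => [Tt|/accP[_ /(_ _ zt)[s Ts /andP[zs st]]]].
  by exists t; rewrite ?zt.
by exists s; rewrite ?zs ?(lt_trans st).
Qed.

(** The blocked case of [reach_local] cannot occur where reached points accumulate; the two others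
    give closedness and prepare coherence. *)
Lemma acc_reach_local T b g : T `<=` limit_ordinal -> g < b ->
  acc (reach T b) g -> reach T b g /\
  ((exists2 b', g < b' & acc (e b') g) \/
   ~ T g /\ exists2 z, z < g &
          forall t, z < t -> t < g -> reach T b t <-> reach T g t).
Proof.
move=> Tlim gb accg.
have Tg : closure T g by right; exact: acc_reach accg.
case: (reach_local Tlim Tg gb) => [[bg exb]|[z zg H]|[nT bg H]].
- by split=> //; left.
- move: accg => /accP[_ /(_ z zg)[t bt /andP[zt tg]]].
  by case: (H t zt tg).
- by split=> //; right.
Qed.

(* Since the step targets decrease with T, each step of the walk towards g is
   eventually constant in n, and the walk itself is finite. *)
Lemma reach_stable (T : nat -> set L) b g :
  (forall m n, (m <= n)%N -> T n `<=` T m) -> (forall n, T n g) -> g < b ->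
  exists t, [/\ g <= t, t < b, forall n, T n t &
    exists N, forall n, (N <= n)%N -> reach (T n) b t].
Proof.
move=> Tdecr Tg; elim/(well_founded_ind Lwf): b => b IH gb.
have [x [ex gx xmin]] := ex_first gb.
have /choice[y yP] n : exists y, supremums [set t | T n t /\ t <= x] y.
  by apply: (ex_supremum Lwf (b := x)) => t [].
have [m n mn|N0 yN] := @nonincreasing_stable _ _ Lwf y.
  by apply: (yP n).2 => t [Tt tx]; apply: (yP m).1; split=> //; exact: Tdecr Tt.
have step n : (N0 <= n)%N -> walk_step (T n) b g (y N0).
  by move=> Nn; exists x; split=> //; rewrite -(yN n Nn).
have gy : g <= y N0 by apply: walk_step_ge (step N0 (leqnn _)); left.
have yb := walk_step_lt (step N0 (leqnn _)).
(* If the eventual target [y N0] stays in every [T n], the walk ends there. Otherwise it drops out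
   at some [m], and for all later [n] the walk passes through it. *)
have [Ty|] := pselect (forall n, T n (y N0)).
  exists (y N0); split=> //; exists N0 => n Nn; apply: reach_hit; first by left.
  exact: walk_step_between (step n Nn) gy (lexx _).
move=> /existsNP[m nTm].
have gy' : g < y N0.
  by rewrite lt_neqAle gy andbT; apply/eqP => gy0; apply: nTm; rewrite -gy0.
have [t [gt ty Tt [N tN]]] := IH _ yb gy'.
exists t; split=> //; first exact: lt_trans yb.
exists (maxn N0 (maxn m N)) => n; rewrite !geq_max => /and3P[Nn mn N1n].
apply: reach_step (tN n N1n) => //.
- by apply: walk_step_between (step n Nn) gt _; exact: ltW.
- by move=> Tn; apply: nTm; exact: Tdecr Tn.
Qed.

End Walk.

(** * The guessing system of a set of limit ordinals *)

Section GuessingSystem.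
Context {d : Order.disp_t} {L : orderType d}.
Context (Lwf : well_founded (fun a b : L => a < b)).
Context (S Sstar : set L).
Context (Sstar_cf : forall b, Sstar b -> uncountable_cofinality b).
Context (e : L -> set L) (e_club : forall b, club_in (below b) (e b)).
Context (e_S : forall b g, g < b -> acc (e b) g -> ~ S g).
Context (e_Sstar : forall b g, g < b -> acc (e b) g -> ~ Sstar g).
Implicit Types (T : set L) (a b g : L).

(** Where [T] is bounded in [b], the second branch still supplies a club of limit ordinals for [b]
    in [Sstar], and it has no accumulation point in [Sstar] below [b]. *)
Definition guessing_system T b : set L :=
  if `[< cofinal_in (below b) (T `&` below b) >] then reach e T b
  else acc (e b) `&` below b.

Lemma guessing_system_club T b : T `<=` limit_ordinal -> Sstar b ->
  [/\ guessing_system T b `<=` below b, supremums (guessing_system T b) b,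
      closed_in (below b) (guessing_system T b)
    & forall a, guessing_system T b a -> limit_ordinal a].
Proof.
move=> Tlim /Sstar_cf unc; have blim := uncountable_cofinality_limit unc.
rewrite /guessing_system; case: asboolP => [[_ Tcof]|_].
  have rb : reach e T b `<=` below b by move=> g /reach_lt; apply.
  split=> //.
  - apply: limit_supremums => // g /Tcof[h [Th hb] gh].
    (* For a constant sequence, stability just says that some point at or above [h] is reached. *)
    have [t [ht _ _ [N /(_ N (leqnn N)) bt]]] := reach_stable Lwf e_club
      (T := fun=> T) (fun _ _ _ => @subset_refl _ T) (fun=> Th) hb.
    by exists t => //; exact: le_trans ht.
  - by move=> g gb /acc_reach_local[].
  - by move=> g /reach_closure[/Tlim|/acc_limit].
have aclub := acc_club_in Lwf (@below_initial _ _ b)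
  (uncountable_cofinality_seq_bounded unc) (e_club b).1.
split; [by move=> g []| |exact: aclub.2|by move=> g [/acc_limit]].
by apply: limit_supremums aclub.1.2 => // g [].
Qed.

Lemma guessing_system_coherent T a b : T `<=` limit_ordinal ->
  Sstar a -> Sstar b -> acc (guessing_system T b) a ->
  exists2 g, g < a & guessing_system T b `&` open_interval g a
                     = guessing_system T a `&` open_interval g a.
Proof.
move=> Tlim Sa Sb acca.
have [cb _ _ _] := guessing_system_club Tlim Sb.
have : a <= b.
  rewrite leNgt; apply/negP => ba; move: acca => /accP[_ /(_ _ ba)[g /cb gb /andP[bg _]]].
  by have := lt_trans bg gb; rewrite ltxx.
rewrite le_eqVlt => /orP[/eqP <-|ab]; first by case: acca => -[g ga _]; exists g.
move: acca; rewrite {1 2}/guessing_system; case: asboolP => [_ acca|_]; last first.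
  move=> acca; exfalso; apply: (e_Sstar ab) Sa; apply: acc_acc.
  by apply: acc_sub acca => g [].
have [_ [[b' ab' ea]|[_ [z za H]]]] := acc_reach_local Lwf e_club Tlim ab acca.
  by case: (e_Sstar ab' ea).
(* Accumulation of reached points at [a] forces [T] to be unbounded in [a], so the system at [a] is
   given by the walk too. *)
exists z => //; rewrite /guessing_system asboolT; last first.
  split=> [g []//|g ga].
  have /accP[_ /(_ g ga)[t Tt /andP[gt ta]]] := acc_reach acca.
  by exists t => //; exact: ltW.
by apply/seteqP; split=> t [rt /andP[zt ta]]; split; rewrite /open_interval /= ?zt //; apply/H.
Qed.

(** By [acc_reach_local], an accumulation point in [T] would accumulate a ladder, which is excluded
    in [S]. *)
Lemma guessing_system_nacc T b g : T `<=` limit_ordinal -> T `<=` S -> T g ->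
  reach e T b g -> nacc (reach e T b) g.
Proof.
move=> Tlim TS Tg bg; split=> // /(acc_reach_local Lwf e_club Tlim (reach_lt e_club bg)).
by move=> [_ [[b' gb' /(e_S gb')]|[]//]]; apply; exact: TS.
Qed.

Lemma guessing_system_stable (T : nat -> set L) b :
  T 0 `<=` limit_ordinal -> T 0 `<=` S ->
  (forall m n, (m <= n)%N -> T n `<=` T m) -> Sstar b ->
  cofinal_in (below b) ((\bigcap_n T n) `&` below b) ->
  exists n, supremums (nacc (guessing_system (T n) b) `&` \bigcap_n T n) b.
Proof.
move=> T0lim T0S Tdecr Sb [_ Tcof].
have unc := Sstar_cf Sb; have blim := uncountable_cofinality_limit unc.
have Tlim n : T n `<=` limit_ordinal by move=> g /(Tdecr 0 n (leq0n n))/T0lim.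
have TS n : T n `<=` S by move=> g /(Tdecr 0 n (leq0n n))/T0S.
have cE n : guessing_system (T n) b = reach e (T n) b.
  rewrite /guessing_system asboolT //; split=> [g []//|g /Tcof[t [Tt tb] gt]].
  by exists t => //; split=> //; exact: Tt.
have [n Hn] : exists n, forall g, g < b ->
    exists t, [/\ g <= t, forall n, T n t & reach e (T n) b t].
  (* Bad targets [g n], one for each [n], have a common bound below [b]; the stable walk towards a
     point of the intersection beyond it refutes [g N]. *)
  apply: contrapT => /forallNP nH.
  have /choice[g gP] n : exists g, g < b /\
      forall t, ~ [/\ g <= t, forall n, T n t & reach e (T n) b t].
    by have /existsNP[g /not_implyP[gb /forallNP Hg]] := nH n; exists g.
  have [n|h hb gh] := uncountable_cofinality_seq_bounded unc (f := g).
    by case: (gP n).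
  have [t [Tt tb] ht] := Tcof h hb.
  have [n|s [ts sb Ts [N /(_ N (leqnn N)) Ns]]] := reach_stable Lwf e_club Tdecr _ tb.
    exact: Tt.
  apply: ((gP N).2 s); split=> //.
  by apply: ltW; apply: lt_le_trans (gh N) (le_trans ht ts).
exists n; rewrite cE; apply: limit_supremums => // [g [[bg _] _]|g gb].
  exact: reach_lt bg.
have [t [gt Tt bt]] := Hn g gb; exists t => //; split=> //.
exact: guessing_system_nacc.
Qed.

End GuessingSystem.

(** * Coding countably many subsets as one *)

Section Coding.
Context {d : Order.disp_t} {L : orderType d}.
Context (Lwf : well_founded (fun a b : L => a < b)).
Implicit Types a b : L.

(* Writing ordinals as l + m with m finite and l not a successor, the code of
   (n, l + m) is l + <n, m> with a pairing function on the naturals. *)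
Lemma ex_coding : (forall a, exists b, a < b) -> exists code : nat -> L -> L,
  (forall m n a b, code m a = code n b -> m = n /\ a = b) /\
  (forall n a b, limit_ordinal a -> b < a -> code n b < a).
Proof.
move=> nomax.
have /choice[s sP] a : exists b, a < b /\ forall g, a < g -> b <= g.
  have [|b ab bmin] := ex_least Lwf (C := [set b | a < b]); first exact: nomax.
  by exists b.
have s_mono a b : a < b -> s a < s b by move=> /(sP a).2 /le_lt_trans; apply; case: (sP b).
have s_inj : injective s.
  by move=> a b sab; case: (ltgtP a b) => // /s_mono; rewrite sab ltxx.
have /choice[r rP] a : exists p : L * nat, (forall b, p.1 <> s b) /\ iter p.2 s p.1 = a.
  elim/(well_founded_ind Lwf): a => a IH.
  have [[b ab]|na] := pselect (exists b, a = s b); last first.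
    by exists (a, 0); split=> //= b ab; apply: na; exists b.
  have [|[l m] [ll lm]] := IH b; first by rewrite ab; case: (sP b).
  by exists (l, m.+1); split=> //=; rewrite ab -lm.
have iter_inj m n l l' : (forall b, l <> s b) -> (forall b, l' <> s b) ->
    iter m s l = iter n s l' -> m = n /\ l = l'.
  move=> ll ll'; elim: m n => [|m IH] [|n] //=.
  - by move=> /ll.
  - by move=> /esym/ll'.
  - by move=> /s_inj/IH[-> ->].
exists (fun n a => iter (pickle (n, (r a).2)) s (r a).1); split.
  move=> m n a b /(iter_inj _ _ _ _ (rP a).1 (rP b).1)[].
  move=> /(pcan_inj pickleK)[-> rab] rab1; split=> //.
  by rewrite -(rP a).2 -(rP b).2 rab rab1.
move=> n a b alim ba.
have s_lim g : g < a -> s g < a.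
  by move=> /alim.2[h gh]; apply: le_lt_trans; exact: (sP g).2.
have iter_le k l : l <= iter k s l.
  by elim: k => //= k IH; apply: le_trans IH _; apply: ltW; case: (sP (iter k s l)).
have rb : (r b).1 < a by apply: le_lt_trans ba; rewrite -{2}(rP b).2.
by elim: (pickle _) => //= k /s_lim.
Qed.

End Coding.

(** * Iterating the failures and refuting them by diamond *)

Theorem theorem3 (d : Order.disp_t) (L : orderType d)
    (L_regular : regular_cardinal L) (L_gt_aleph1 : gt_aleph1 L)
    (S : set L) (S_stat : stationary S) (S_nonrefl : non_reflecting S)
    (A : L -> set L) (A_diamond : diamond_sequence S A)
    (Sstar : set L) (Sstar_stat : stationary Sstar)
    (Sstar_nonrefl : non_reflecting Sstar)
    (Sstar_S : Sstar `&` S = set0)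
    (Sstar_cf : forall delta, Sstar delta -> uncountable_cofinality delta) :
  exists (c : L -> set L) (B : L -> set L),
    [/\ forall alpha, S alpha -> B alpha `<=` below alpha,
        forall delta, Sstar delta ->
          [/\ c delta `<=` below delta,
              supremums (c delta) delta,
              closed_in (below delta) (c delta)
            & forall alpha, c delta alpha -> limit_ordinal alpha],
        forall delta deltastar, Sstar delta -> Sstar deltastar ->
          acc (c deltastar) delta ->
          exists2 alpha, alpha < delta
            & c deltastar `&` open_interval alpha delta
              = c delta `&` open_interval alpha delta
      & forall E : set L, club E -> forall X : set L,
          stationary [set delta | Sstar delta /\
            supremums [set alpha | [/\ nacc (c delta) alpha, S alpha, E alpha
                                     & X `&` below alpha = B alpha]] delta]].
Proof.
case: L_regular => Lwf _ _ Lcof; case: A_diamond => _ A_guess.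
have Lseq : seq_bounded [set: L].
  apply: cofinality_seq_bounded Lcof _ => cT; case: L_gt_aleph1 => w [wunc _].
  by apply: wunc; apply: sub_countable cT; exact: subset_card_le.
have nomax (a : L) : exists b, a < b.
  by have [//|b _ ab] := Lseq (fun=> a); exists b; exact: (ab 0).
have /choice[e eP] b := ex_ladder Lwf b S_nonrefl Sstar_nonrefl.
have e_club b : club_in (below b) (e b) by case: (eP b).
have e_S b g : g < b -> acc (e b) g -> ~ S g by case: (eP b) => _ + _; apply.
have e_Sstar b g : g < b -> acc (e b) g -> ~ Sstar g by case: (eP b) => _ _; apply.
have [code [code_inj code_lim]] := ex_coding Lwf nomax.
pose B n alpha : set L := [set b | b < alpha /\ A alpha (code n b)].
apply: contrapT => fails.
(* A failure of (iv) yields a club [E], a set [X] and a club [D] on which no point of [Sstar]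
   guesses; (i) to (iii) hold for every such system. *)
have counterexample (nT : nat * set L) : exists EXD : set L * set L * set L,
    nT.2 `<=` limit_ordinal -> [/\ club EXD.1.1, club EXD.2 &
      forall delta, EXD.2 delta -> Sstar delta ->
      ~ supremums [set alpha | [/\ nacc (guessing_system e nT.2 delta) alpha,
          S alpha, EXD.1.1 alpha & EXD.1.2 `&` below alpha = B nT.1 alpha]] delta].
  case: nT => n T /=.
  have [Tlim|] := pselect (T `<=` limit_ordinal); last by exists (set0, set0, set0).
  apply: contrapT => nEXD; apply: fails; exists (guessing_system e T), (B n); split.
  - by move=> alpha _ b [].
  - by move=> delta; exact: guessing_system_club.
  - by move=> delta deltastar; exact: guessing_system_coherent.
  move=> E clubE X; split=> // D clubD; apply: contrapT => nD; apply: nEXD.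
  exists (E, X, D) => _; split=> //= delta Ddelta Sdelta sup; apply: nD.
  by exists delta.
have [F FP] := choice counterexample.
pose T := fix T n : set L := if n is m.+1 then
    T m `&` [set alpha | (F (m, T m)).1.1 alpha /\
                         (F (m, T m)).1.2 `&` below alpha = B m alpha]
  else S `&` limit_ordinal.
have Tdecr m n : (m <= n)%N -> T n `<=` T m.
  elim: n => [|n IH]; first by rewrite leqn0 => /eqP ->.
  by rewrite leq_eqVlt => /orP[/eqP -> //|/IH TT] g [/TT].
have Tlim n : T n `<=` limit_ordinal by move=> g /(Tdecr 0 n (leq0n n))[].
pose E n := (F (n, T n)).1.1; pose X n := (F (n, T n)).1.2; pose D n := (F (n, T n)).2.
have E_club n : club (E n) by case: (FP (n, T n) (Tlim n)).
have D_club n : club (D n) by case: (FP (n, T n) (Tlim n)).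
(* The [X n] were built from [A] alone, so a single set can now code them all for diamond to
   guess. *)
pose Y := [set y | exists n b, y = code n b /\ X n b].
have lim_club : club (acc setT `&` [set: L]).
  by apply: acc_club_in => //; split=> // b _; exists b.
(* Codes of ordinals below a limit [alpha] stay below [alpha], so guessing [Y] there guesses every
   [X n] at once. *)
have T_guess alpha : S alpha -> limit_ordinal alpha -> (forall n, E n alpha) ->
    Y `&` below alpha = A alpha -> forall n, T n alpha.
  move=> Sa alim Ea Ya; elim=> [|n IH] //=; split=> //; split; first exact: Ea.
  apply/seteqP; split=> b [].
    move=> Xb ba; split=> //; rewrite -Ya; split; first by exists n, b.
    exact: code_lim.
  move=> ba; rewrite -Ya => -[[m [b' [/code_inj[<- <-] Xb]]] _].
  by split.
have Tcof : cofinal_in [set: L] (\bigcap_n T n).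
  split=> // b _.
  have tail_club : club [set g | b < g].
    split; first split=> // g _.
      have [h] := nomax (Order.max b g); rewrite gt_max => /andP[bh gh].
      by exists h => //; exact: ltW.
    by move=> g _ /accP[[h hg] /(_ h hg)[k bk /andP[_ kg]]]; exact: lt_trans kg.
  have Eclub := bigcap_club_in Lwf (@setT_initial _ L) Lseq E_club.
  have clubI := setI_club_in Lwf (@setT_initial _ L) Lseq.
  have [_ /(_ _ (clubI _ _ (clubI _ _ Eclub lim_club) tail_club))] := A_guess Y.
  move=> [alpha [[Sa Ya] [[Ea [/acc_limit alim _]] ba]]].
  exists alpha; last exact: ltW.
  by move=> n _; apply: T_guess => // m; exact: Ea.
have accT_club := acc_club_in Lwf (@setT_initial _ L) Lseq Tcof.
have Dclub := bigcap_club_in Lwf (@setT_initial _ L) Lseq D_club.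
have [_ /(_ _ (setI_club_in Lwf (@setT_initial _ L) Lseq accT_club Dclub))] := Sstar_stat.
move=> [delta [Sdelta [[/accP[_ accT] _] Ddelta]]].
have [|||n] := guessing_system_stable Lwf Sstar_cf e_club e_S (T := T) _ _ Tdecr Sdelta.
- exact: Tlim.
- by move=> g [].
- split=> [g []//|g /accT[t Tt /andP[gt td]]].
  by exists t => //; exact: ltW.
move=> [_ supn]; have [_ _ /(_ delta (Ddelta n I) Sdelta)] := FP (n, T n) (Tlim n).
apply; split.
  move=> g [[cg _] _ _ _] /=; apply: ltW.
  by have [cb _ _ _] := guessing_system_club Lwf Sstar_cf e_club (Tlim n) Sdelta; exact: cb.
(* Membership in [T n.+1] says that [g] lies in [E n] and guesses [X n], so the system of [T n]
   guesses at [delta], against the choice of [D n]. *)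
move=> u uub; apply: supn => g [cg Tg]; apply: uub => /=.
have [_ [Eg Xg]] := Tg n.+1 I; split=> //.
by have [] := Tg 0 I.
Qed.
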